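(* Consider $\mathcal{X},\mathcal{Y}\subset\mathbb{R}$ and $q:\mathcal{X}\times\mathcal{Y}\to[0,\infty)$, $(x,y)\mapsto q(y|x)$. For a probability distribution $P$ on $\mathcal{X}$, call $P$ admissible if $\mathbb{E}_{X\sim P}\left((1+|X|)\,q(y|X)\right)<\infty$ for all $y\in\mathcal{Y}$; for admissible $P$ let $\mathcal{Y}_P:=\{y\in\mathcal{Y}:\ \mathbb{E}_{X\sim P}(q(y|X))>0\}$ and $$f_P(y):=\frac{\mathbb{E}_{X\sim P}\left(X\,q(y|X)\right)}{\mathbb{E}_{X\sim P}\left(q(y|X)\right)},\qquad y\in\mathcal{Y}_P .$$ The following properties are equivalent: (a) for any admissible $P$, $f_P$ implements a proximity operator; (b) for any $x,x'\in\mathcal{X}$, $y,y'\in\mathcal{Y}$ with $x'>x$ and $y'>y$, $\ q(y'|x')q(y|x)-q(y'|x)q(y|x')\ge0$. If $q(y|x)>0$ on $\mathcal{X}\times\mathcal{Y}$ then (a)-(b) are further equivalent to each of: (c) for any $y,y'\in\mathcal{Y}$ with $y'>y$, the function $x\mapsto\log q(y'|x)-\log q(y|x)$ is non-decreasing; (d) for any $x,x'\in\mathcal{X}$ with $x'>x$, the function $y\mapsto\log q(y|x')-\log q(y|x)$ is non-decreasing. If $\frac{\partial}{\partial y}\log q(y|x)$ exists on $\mathcal{X}\times\mathcal{Y}$, then (a)-(b) are further equivalent to: (e) for any $y\in\mathcal{Y}$, the function $x\mapsto\frac{\partial}{\partial y}\log q(y|x)$ is non-decreasing. If $\frac{\partial}{\partial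 x}\log q(y|x)$ exists on $\mathcal{X}\times\mathcal{Y}$, then (a)-(b) are further equivalent to: (f) for any $x\in\mathcal{X}$, the function $y\mapsto\frac{\partial}{\partial x}\log q(y|x)$ is non-decreasing.
   Context: A function $f:S\to\mathbb{R}$ with $S\subset\mathbb{R}$ implements a proximity operator if there is a (possibly nonconvex) proper function $\varphi:\mathbb{R}\to\mathbb{R}\cup\{+\infty\}$ (i.e. not identically $+\infty$) such that $f(y)\in\mathrm{prox}_\varphi(y):=\arg\min_{x\in\mathbb{R}}\{\frac12(y-x)^2+\varphi(x)\}$ for every $y\in S$. In (c) and (e) the functions of $x$ are defined on $\mathcal{X}$; in (d) and (f) the functions of $y$ are defined on $\mathcal{Y}$. Existence of a partial derivative of $\log q$ on $\mathcal{X}\times\mathcal{Y}$ includes that $\log q$ is finite there, i.e. $q>0$.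
   Formalization: The equivalence with (e) is proved for 𝒴 an interval and that with (f) for 𝒳 an interval (one-sided derivatives at endpoints); without this it fails, e.g. 𝒳={0,1}, 𝒴=(0,1)∪(2,3), q(y|0)=1, q(y|1)=2 on (0,1) and 1 on (2,3). *)

(* Defs.v *)
(* MathComp-Analysis *)
From HB Require Import structures.
From mathcomp Require Import all_boot all_order all_algebra.
From mathcomp Require Import all_classical all_reals all_analysis.

Set Implicit Arguments.
Unset Strict Implicit.
Unset Printing Implicit Defensive.

Import Order.TTheory GRing.Theory Num.Theory.
Import numFieldNormedType.Exports.

Local Open Scope classical_set_scope.
Local Open Scope ring_scope.

(* [measurableType]s are pointed, whereas a set X may be empty.  A set carrying
   a probability is inhabited, so X is pointed at an arbitrary x0 : X; the
   choice of x0 has no influence on the sigma-algebra below. *)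
Definition pointed_at (R : realType) (X : set R) (x0 : X) : Type := X.
HB.instance Definition _ (R : realType) (X : set R) (x0 : X) :=
  Choice.on (pointed_at x0).
HB.instance Definition _ (R : realType) (X : set R) (x0 : X) :=
  isPointed.Build (pointed_at x0) x0.

(* X with the trace of the Borel sigma-algebra of R. *)
Definition borel_on (R : realType) (X : set R) (x0 : X) :=
  g_sigma_algebra_preimageType
    ((fun x : X => \val x) : pointed_at x0 -> measurableTypeR R).

Definition to_real (R : realType) (X : set R) (x0 : X) (x : borel_on x0) : R :=
  \val (x : X).

(* Integrability with respect to the completion of P, so that no measurability
   of q(y|.) has to be presupposed; for measurable f this is integrability.
   The library integral of such an f equals that of g. *)
Definition integrable_ae d (T : measurableType d) (R : realType)
    (P : probability T R) (f : T -> R) : Prop :=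
  exists g : T -> R,
    P.-integrable setT (EFin \o g) /\ {ae P, forall t, g t = f t}.

(* Throughout, q x y stands for q(y|x). *)
Section Bayes.
Context (R : realType) (X Y : set R) (q : R -> R -> R).
Context (x0 : X) (P : probability (borel_on x0) R).

Definition admissible : Prop :=
  forall y, Y y ->
    integrable_ae P (fun x => (1 + `|to_real x|) * q (to_real x) y).

Definition bayes_dom : set R :=
  [set y | Y y /\ (0 < 'E_P[fun x => q (to_real x) y])%E].

Definition bayes_mean (y : R) : R :=
  fine 'E_P[fun x => to_real x * q (to_real x) y] /
  fine 'E_P[fun x => q (to_real x) y].

End Bayes.

Definition prox (R : realType) (phi : R -> \bar R) (y : R) : set R :=
  [set x | forall z, ((2^-1 * (y - x) ^+ 2)%:E + phi x
                      <= (2^-1 * (y - z) ^+ 2)%:E + phi z)%E].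

Definition implements_prox (R : realType) (S : set R) (f : R -> R) : Prop :=
  exists phi : R -> \bar R,
    [/\ forall x, phi x != -oo%E,
        exists x, phi x != +oo%E
      & forall y, S y -> prox phi y (f y)].

Section DeriveWithin.
Context (R : realType) (A : set R) (f : R -> R) (x : R).

Let slope (z : R) : R := (z - x)^-1 * (f z - f x).

(* Derivative at x of a function whose domain is A: the ordinary derivative
   when x is interior to A, the one-sided one at an endpoint of an interval. *)
Definition derivable_within : Prop :=
  limit_point A x /\ cvg (slope z @[z --> within A x^']).

Definition derive_within : R := lim (slope z @[z --> within A x^']).

End DeriveWithin.

Section Conditions.
Context (R : realType) (X Y : set R) (q : R -> R -> R).

Definition bayes_is_prox : Prop :=
  forall (x0 : X) (P : probability (borel_on x0) R),
    admissible Y q P -> implements_prox (bayes_dom Y q P) (bayes_mean q P).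

Definition monotone_likelihood_ratio : Prop :=
  forall x x' y y', X x -> X x' -> Y y -> Y y' -> x < x' -> y < y' ->
    0 <= q x' y' * q x y - q x y' * q x' y.

Definition positive_on : Prop :=
  forall x y, X x -> Y y -> 0 < q x y.

End Conditions.

(* Main.v *)
(* A function implements a proximity operator iff it is nondecreasing, so (a)
   says that every [f_P] is nondecreasing.  Under (b) the quantity
   [(s - t) * (q(y'|s) q(y|t) - q(y'|t) q(y|s))] is nonnegative for all [s],
   [t]; integrating it in [t] and then in [s] against [P] gives
   [f_P(y) <= f_P(y')].  Conversely, for [P] uniform on [{x, x'}] the inequality
   [f_P(y) <= f_P(y')] is (b). *)
Require Import Defs.
From HB Require Import structures.
From mathcomp Require Import all_boot all_order all_algebra.
From mathcomp Require Import all_classical all_reals all_analysis.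
From mathcomp Require Import measurable_realfun ring lra.
Set Implicit Arguments.
Unset Strict Implicit.
Unset Printing Implicit Defensive.
Import Order.TTheory GRing.Theory Num.Theory.
Import numFieldNormedType.Exports.
Local Open Scope classical_set_scope.
Local Open Scope ring_scope.

(** * Cyclic monotonicity on the line *)

(** The sums of Rockafellar's cyclic monotonicity: [f] is cyclically monotone when they are
    nonpositive on every closed chain. *)
Fixpoint chain_sum {R : pzRingType} (f : R -> R) (a : R) (s : seq R) : R :=
  if s is b :: s' then f a * (b - a) + chain_sum f b s' else 0.

Lemma chain_sum_cat {R : pzRingType} (f : R -> R) (a : R) (s1 s2 : seq R) :
  chain_sum f a (s1 ++ s2) = chain_sum f a s1 + chain_sum f (last a s1) s2.
Proof. by elim: s1 a => [|b s IHs] a /=; rewrite ?add0r // IHs addrA. Qed.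

Lemma chain_sum_rcons {R : pzRingType} (f : R -> R) (a b : R) (s : seq R) :
  chain_sum f a (rcons s b) = chain_sum f a s + f (last a s) * (b - last a s).
Proof. by rewrite -cats1 chain_sum_cat /= addr0. Qed.

(** Both sums run over the same two arcs, from [a] to [b] through [s1] and from [b] to [a] through
    [s2]. *)
Lemma closed_chain_sum_rot {R : pzRingType} (f : R -> R) (a b : R)
    (s1 s2 : seq R) :
  chain_sum f a (rcons (s1 ++ b :: s2) a) =
  chain_sum f b (rcons (s2 ++ a :: s1) b).
Proof.
by rewrite -!cats1 -!catA !chain_sum_cat /= !addr0 !addrA -[LHS]addrA
  -[RHS]addrA addrC.
Qed.

Lemma exists_seq_max {R : realDomainType} (a : R) (s : seq R) :
  exists2 m, m \in a :: s & forall x, x \in a :: s -> x <= m.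
Proof.
elim: s a => [|b s IHs] a.
  by exists a => [|x]; rewrite inE // => /eqP ->.
have [m ms mmax] := IHs b; have [am|ma] := leP a m.
  exists m; first by rewrite inE ms orbT.
  by move=> x; rewrite inE => /predU1P[->|/mmax].
exists a; first exact: mem_head.
by move=> x; rewrite inE => /predU1P[-> //|/mmax xm]; exact: le_trans (ltW ma).
Qed.

(* Dropping the largest point of a closed chain does not decrease the sum;
   by rotation that point may be taken to be the base point. *)
Lemma closed_chain_sum_le0 {R : realDomainType} (S : set R) (f : R -> R)
    (a : R) (s : seq R) :
  {in S &, nondecreasing_fun f} -> {subset a :: s <= S} ->
  chain_sum f a (rcons s a) <= 0.
Proof.
move=> fmono; have [n] := ubnP (size s); elim: n a s => // n IHn a s.
rewrite ltnS => sn sS.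
wlog amax : a s sn sS / forall x, x \in a :: s -> x <= a.
  move=> base; have [m ms mmax] := exists_seq_max a s.
  move: (ms); rewrite inE => /predU1P[ma|/splitPr ms'].
    by apply: base => // x xs; rewrite -ma; exact: mmax.
  case: ms' sn sS mmax {ms} => s1 s2 sn sS mmax; rewrite closed_chain_sum_rot.
  have perm : m :: s2 ++ a :: s1 =i a :: s1 ++ m :: s2.
    by apply: perm_mem; apply/permPl; exact: (perm_catC (m :: s2) (a :: s1)).
  apply: base; first by move: sn; rewrite !size_cat /= addnC addSnnS.
    by move=> x; rewrite perm => /sS.
  by move=> x; rewrite perm => /mmax.
case: s sn sS amax => [|b s] /= sn sS amax; first by rewrite subrr mulr0 addr0.
rewrite chain_sum_rcons.
have bsub : {subset b :: s <= S} by move=> x xs; apply: sS; rewrite inE xs orbT.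
have := IHn b s sn bsub; rewrite chain_sum_rcons.
set l := last b s => ind.
have ls : l \in a :: b :: s by rewrite inE mem_last orbT.
have fla : f l <= f a.
  by apply: fmono; [exact: sS|apply: sS; exact: mem_head|exact: amax].
have ba : b <= a by apply: amax; rewrite !inE eqxx orbT.
(* This product is the sum over the closed chain minus the sum over the chain with [a] removed,
   where [l] is followed directly by [b]. *)
suff : (f a - f l) * (b - a) <= 0 by lra.
by rewrite mulr_ge0_le0 ?subr_ge0 ?subr_le0.
Qed.

(* Rockafellar's construction of a convex function with prescribed
   subgradients. *)
Lemma nondecreasing_subgradient {R : realType} (S : set R) (f : R -> R) :
  {in S &, nondecreasing_fun f} ->
  exists g : R -> R, forall y z, S y -> S z -> f y * (z - y) <= g z - g y.
Proof.
move=> fmono; have [->|/set0P[y0 Sy0]] := eqVneq S set0.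
  by exists (fun=> 0).
exists (fun y => sup [set chain_sum f y0 (rcons s y) | s in
  [set s : seq R | {subset s <= S}]]).
  have ub y : S y -> has_sup [set chain_sum f y0 (rcons s y) | s in
      [set s : seq R | {subset s <= S}]].
    move=> Sy; split; first by exists (chain_sum f y0 [:: y]), [::].
    (* Returning from [y] to [y0] adds [f y * (y0 - y)] and closes the chain, whose total is then
       nonpositive. *)
    exists (f y * (y - y0)) => _ [s sS <-].
    have : chain_sum f y0 (rcons (rcons s y) y0) <= 0.
      apply: (closed_chain_sum_le0 fmono) => x.
      rewrite inE mem_rcons inE => /predU1P[->|/predU1P[->|/sS //]];
        by rewrite inE.
    by rewrite chain_sum_rcons last_rcons; lra.
  move=> y z Sy Sz; rewrite lerBrDr -lerBrDl; apply: ge_sup.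
    by have [] := ub y Sy.
  move=> _ [s sS <-]; rewrite lerBrDl; apply: ub_le_sup.
    by have [] := ub z Sz.
  (* A chain ending at [y], prolonged to [z], gains exactly [f y * (z - y)]. *)
  exists (rcons s y).
    by move=> x; rewrite mem_rcons inE => /predU1P[->|/sS //]; rewrite inE.
  by rewrite chain_sum_rcons last_rcons addrC.
Qed.

(** * Proximity operators as nondecreasing functions *)

(** Take [phi] to be the Fenchel conjugate of [g] over [S] minus half the square. Expanding the
    square, the prox objective at [x] becomes the conjugate at [x] minus [x * y], up to a term in
    [y] alone. By the Fenchel-Young inequality this is at least [- g y], with equality at [x = f y]
    because [f y] is a subgradient of [g] at [y]. *)
Lemma nondecreasing_implements_prox {R : realType} (S : set R) (f : R -> R) :
  {in S &, nondecreasing_fun f} -> implements_prox S f.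
Proof.
move=> fmono; have [->|/set0P[y0 Sy0]] := eqVneq S set0.
  by exists (fun=> 0%E); split=> // ; exists 0.
have [g fg] := nondecreasing_subgradient fmono.
pose phi x :=
  (ereal_sup [set (x * y - g y)%:E | y in S] - (2^-1 * x ^+ 2)%:E)%E.
have phi_ge x y : S y -> ((x * y - g y - 2^-1 * x ^+ 2)%:E <= phi x)%E.
  move=> Sy; rewrite EFinB; apply: leeB => //.
  by apply: ereal_sup_ubound; exists y.
have phi_le y : S y -> (phi (f y) <= (f y * y - g y - 2^-1 * f y ^+ 2)%:E)%E.
  move=> Sy; rewrite EFinB; apply: leeB => //.
  apply: ge_ereal_sup => _ [z Sz <-]; rewrite lee_fin.
  by have := fg _ _ Sy Sz; lra.
exists phi; split.
- move=> x; rewrite -ltNye; apply: lt_le_trans (phi_ge x _ Sy0).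
  exact: ltNyr.
- exists (f y0); rewrite -ltey; apply: le_lt_trans (phi_le _ Sy0) _.
  exact: ltry.
- move=> y Sy z.
  have := leeD2l (2^-1 * (y - f y) ^+ 2)%:E (phi_le _ Sy).
  move=> /le_trans; apply.
  apply: le_trans (leeD2l (2^-1 * (y - z) ^+ 2)%:E (phi_ge z _ Sy)).
  by rewrite -!EFinD lee_fin; lra.
Qed.

(** Test the minimality of [f y] against [f z] and that of [f z] against [f y]. In the sum of the
    two inequalities [phi] and the squares cancel, leaving [0 <= (z - y) * (f z - f y)]. *)
Lemma implements_prox_nondecreasing {R : realType} (S : set R) (f : R -> R) :
  implements_prox S f -> {in S &, nondecreasing_fun f}.
Proof.
move=> [phi [phiNy [x0 phi0] fprox]].
(* The objective is finite at [x0], hence also at a minimizer; this is what allows [phi] to be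
   cancelled. *)
have phi_fin y : S y -> exists r, phi (f y) = r%:E.
  move=> Sy; exists (fine (phi (f y))); rewrite fineK //.
  rewrite fin_numE phiNy /=; apply: contra_neq phi0 => phiy.
  have := fprox y Sy x0; rewrite phiy addey // leye_eq.
  by case: (phi x0) (phiNy x0) => //.
move=> y z /set_mem Sy /set_mem Sz; rewrite le_eqVlt => /predU1P[->//|yz].
have [a ya] := phi_fin y Sy; have [b zb] := phi_fin z Sz.
have := fprox y Sy (f z); have := fprox z Sz (f y).
rewrite ya zb -!EFinD !lee_fin => h1 h2.
rewrite -subr_ge0 -(pmulr_rge0 _ (_ : 0 < z - y)) ?subr_gt0 //.
by lra.
Qed.

(** * Integrals modulo null sets and weighted means *)

Section IntegralOffNullSet.
Context d (T : measurableType d) (R : realType).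
Variable mu : {measure set T -> \bar R}.

Import HBNNSimple.

(* [f] and [g] need not be measurable: the library integral of a nonnegative
   function is the supremum of the integrals of the simple functions below it,
   and these may be set to zero on [N]. *)
Lemma integral_eq_off_null_set (N : set T) (f g : T -> \bar R) :
  measurable N -> mu N = 0%E -> (forall x, ~ N x -> f x = g x) ->
  (\int[mu]_x f x = \int[mu]_x g x)%E.
Proof.
move=> mN N0.
pose nnint (f' : T -> \bar R) := ereal_sup [set sintegral mu h |
  h in [set h : {nnsfun T >-> R} | forall x, ((h x)%:E <= f' x)%E]].
have le_nnint (f' g' : T -> \bar R) : (forall x, 0 <= g' x)%E ->
    (forall x, ~ N x -> f' x = g' x) -> (nnint f' <= nnint g')%E.
  move=> g'0 fg'; apply: ge_ereal_sup => _ [h hf <-].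
  apply: ereal_sup_ubound; exists (proj_nnsfun h (measurableC mN)).
    move=> x; rewrite -mrestrict /patch; case: ifPn => [/set_mem xN|_ //].
    by rewrite -fg'.
  rewrite -!integralT_nnsfun; apply: ge0_ae_eq_integral => //.
  - exact/measurable_EFinP.
  - exact/measurable_EFinP.
  - by move=> x _; rewrite lee_fin.
  - by move=> x _; rewrite lee_fin.
  - exists N; split=> // x /= hx; apply: contrapT => Nx; apply: hx => _.
    by rewrite mindicE mem_set // mulr1.
have eq_nnint (f' g' : T -> \bar R) : (forall x, 0 <= f' x)%E ->
    (forall x, 0 <= g' x)%E -> (forall x, ~ N x -> f' x = g' x) ->
    nnint f' = nnint g'.
  move=> f'0 g'0 fg'; apply/eqP; rewrite eq_le !le_nnint // => x Nx.
  by rewrite fg'.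
move=> fg; rewrite /integral !patch_setT; congr (_ - _)%E; apply: eq_nnint => x;
  rewrite ?funepos_ge0 ?funeneg_ge0 //.
  by move=> Nx; rewrite !funeposE fg.
by move=> Nx; rewrite !funenegE fg.
Qed.

End IntegralOffNullSet.

Section WeightedMean.
Context d (T : measurableType d) (R : realType).
Variable mu : {measure set T -> \bar R}.

Lemma Rintegral_lincomb4 (a b c e : R) (f g h k : T -> R) :
  mu.-integrable setT (EFin \o f) -> mu.-integrable setT (EFin \o g) ->
  mu.-integrable setT (EFin \o h) -> mu.-integrable setT (EFin \o k) ->
  \int[mu]_x (a * f x + b * g x + c * h x + e * k x) =
  a * \int[mu]_x f x + b * \int[mu]_x g x + c * \int[mu]_x h x +
  e * \int[mu]_x k x.
Proof.
have intZ r p : mu.-integrable setT (EFin \o p) ->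
    mu.-integrable setT (EFin \o (fun x => r * p x)).
  by move=> ip; apply: eq_integrable (integrableZl measurableT r ip) => // x _.
have intD p p' : mu.-integrable setT (EFin \o p) ->
    mu.-integrable setT (EFin \o p') ->
    mu.-integrable setT (EFin \o (fun x => p x + p' x)).
  move=> ip ip'.
  by apply: eq_integrable (integrableD measurableT ip ip') => // x _.
move=> fi gi hi ki.
have afi := intZ a f fi; have bgi := intZ b g gi.
have chi := intZ c h hi; have eki := intZ e k ki.
have abi := intD _ _ afi bgi; have abci := intD _ _ abi chi.
by rewrite !RintegralD // !RintegralZl.
Qed.

(* Integrate [(X s - X t) * (v s * u t - v t * u s)], which is nonnegative,
   first over [t] and then over [s]. *)
Lemma le_weighted_mean (X u v : T -> R) :
  mu.-integrable setT (EFin \o u) -> mu.-integrable setT (EFin \o v) ->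
  mu.-integrable setT (EFin \o (fun t => X t * u t)) ->
  mu.-integrable setT (EFin \o (fun t => X t * v t)) ->
  (forall s t, X t < X s -> 0 <= v s * u t - v t * u s) ->
  (\int[mu]_t (X t * u t)) * (\int[mu]_t v t) <=
  (\int[mu]_t (X t * v t)) * (\int[mu]_t u t).
Proof.
move=> ui vi Xui Xvi uv.
set A := \int[mu]_t (X t * u t); set B := \int[mu]_t u t.
set A' := \int[mu]_t (X t * v t); set B' := \int[mu]_t v t.
have ge0 s t : 0 <= (X s - X t) * (v s * u t - v t * u s).
  have [ts|st|->] := ltgtP (X t) (X s); last by rewrite subrr mul0r.
    by rewrite mulr_ge0 ?subr_ge0 ?(ltW ts) // -subr_ge0 uv.
  by rewrite mulr_le0 ?subr_le0 ?(ltW st) // -subr_ge0 uv.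
have inner s : 0 <= B * (X s * v s) + - B' * (X s * u s) + - A * v s + A' * u s.
  have -> : B * (X s * v s) + - B' * (X s * u s) + - A * v s + A' * u s =
      \int[mu]_t ((X s * v s) * u t + - (X s * u s) * v t
        + - v s * (X t * u t) + u s * (X t * v t)).
    by rewrite Rintegral_lincomb4 //; rewrite -/A -/B -/A' -/B'; ring.
  apply: Rintegral_ge0 => t _; have := ge0 s t; congr (0 <= _); ring.
have : 0 <= \int[mu]_s (B * (X s * v s) + - B' * (X s * u s) + - A * v s
    + A' * u s) by apply: Rintegral_ge0.
by rewrite Rintegral_lincomb4 // -/A -/B -/A' -/B'; lra.
Qed.

End WeightedMean.

(** The weight [1 + |X|] dominates both [1] and [|X|], so one integrability assumption controls [f]
    and [X * f]. Any measurable [M] containing [N] is allowed, so that two functions can share one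
    exceptional set. *)
Lemma integrable_off_null_set d (T : measurableType d) (R : realType)
    (P : probability T R) (X f : T -> R) :
  measurable_fun setT X -> Defs.integrable_ae P (fun t => (1 + `|X t|) * f t) ->
  exists N : set T, [/\ measurable N, P N = 0%E & forall M : set T,
    measurable M -> N `<=` M ->
    P.-integrable setT (EFin \o (f \_ (~` M))) /\
    P.-integrable setT (EFin \o (fun t => X t * (f \_ (~` M)) t))].
Proof.
move=> mX [g [gi [N [mN N0 gN]]]]; exists N; split=> // M mM NM.
have gE t : ~ M t -> g t = (1 + `|X t|) * f t.
  by move=> Mt; apply: contrapT => gt; apply/Mt/NM/gN.
have X1 t : 0 < 1 + `|X t| by rewrite ltr_pwDl.
(* Dividing the measurable [g] by the positive weight recovers [f] off [M], which gives the
   measurability that [f] itself may lack. *)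
have fE t : (f \_ (~` M)) t = g t * ((1 + `|X t|)^-1 * \1_(~` M) t).
  rewrite /patch indicE; case: ifPn => [/set_mem Mt|_]; last by rewrite !mulr0.
  by rewrite mulr1 gE // mulrAC divff ?mul1r // gt_eqF.
have mg : measurable_fun setT g.
  by apply/measurable_EFinP; exact: measurable_int gi.
have mf : measurable_fun setT (f \_ (~` M)).
  rewrite (_ : f \_ (~` M) = fun t => g t * ((1 + `|X t|)^-1 * \1_(~` M) t)).
    apply: measurable_funM => //; apply: measurable_funM.
      have mV : measurable_fun setT (fun r : R => (1 + `|r|)^-1).
        apply: continuous_measurable_fun => r; apply: cvgV.
          by rewrite gt_eqF // ltr_pwDl.
        by apply: cvgD; [exact: cvg_cst|exact: norm_continuous].
      exact: (measurableT_comp mV mX).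
    by apply: measurable_indic; exact: measurableC.
  exact/funext.
have le_g t : (1 + `|X t|) * `|(f \_ (~` M)) t| <= `|g t|.
  rewrite /patch; case: ifPn => [/set_mem Mt|_]; last by rewrite normr0 mulr0.
  by rewrite gE // normrM (gtr0_norm (X1 t)).
split; apply: (le_integrable measurableT _ _ gi).
- exact/measurable_EFinP.
- move=> t _ /=; rewrite lee_fin; apply: le_trans (le_g t).
  by rewrite ler_peMl // lerDl.
- by apply/measurable_EFinP; exact: measurable_funM.
- move=> t _ /=; rewrite lee_fin; apply: le_trans (le_g t).
  by rewrite normrM ler_wpM2r // lerDr.
Qed.

Lemma measurable_to_real {R : realType} (X : set R) (x0 : X) :
  measurable_fun setT (@to_real R X x0).
Proof. by move=> _ B mB; exists B. Qed.

Lemma monotone_likelihood_ratio_is_prox {R : realType} (X Y : set R)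
    (q : R -> R -> R) :
  monotone_likelihood_ratio X Y q -> bayes_is_prox X Y q.
Proof.
move=> mlr x0 P adm; apply: nondecreasing_implements_prox.
move=> y y' /set_mem[Yy Ey] /set_mem[Yy' Ey'].
rewrite le_eqVlt => /predU1P[->//|yy'].
have mX := @measurable_to_real R X x0.
have [N [mN N0 Nint]] := integrable_off_null_set mX (adm y Yy).
have [N' [mN' N'0 N'int]] := integrable_off_null_set mX (adm y' Yy').
(* One null set serves both [y] and [y']; [u] and [v] are the two likelihoods set to zero on it. *)
pose M := N `|` N'; have mM : measurable M by exact: measurableU.
have M0 : P M = 0%E by rewrite /M measureU0.
pose u := (fun x : borel_on x0 => q (to_real x) y) \_ (~` M).
pose v := (fun x : borel_on x0 => q (to_real x) y') \_ (~` M).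
have [ui Xui] : P.-integrable setT (EFin \o u) /\
    P.-integrable setT (EFin \o (fun t : borel_on x0 => to_real t * u t)).
  exact: (Nint M mM (@subsetUl _ N N')).
have [vi Xvi] : P.-integrable setT (EFin \o v) /\
    P.-integrable setT (EFin \o (fun t : borel_on x0 => to_real t * v t)).
  exact: (N'int M mM (@subsetUr _ N N')).
have uE x : ~ M x -> q (to_real x) y = u x.
  by move=> Mx; rewrite /u /patch mem_set.
have vE x : ~ M x -> q (to_real x) y' = v x.
  by move=> Mx; rewrite /v /patch mem_set.
have uv (s t : borel_on x0) : to_real t < to_real s ->
    0 <= v s * u t - v t * u s.
  move=> ts; rewrite /u /v /patch.
  (* If [s] or [t] lies in [M], both products vanish; otherwise the likelihood ratio inequality
     applies. *)
  case: ifPn => _; case: ifPn => _; rewrite ?(mulr0, mul0r, subr0) //.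
  by apply: mlr => //; [exact: (set_mem (valP (t : X)))|
    exact: (set_mem (valP (s : X)))].
have := le_weighted_mean ui vi Xui Xvi uv.
have Eu : ('E_P[fun x : borel_on x0 => q (to_real x) y]
    = \int[P]_x (u x)%:E)%E.
  rewrite unlock; apply: (integral_eq_off_null_set mM M0) => x Mx.
  by rewrite uE.
have Ev : ('E_P[fun x : borel_on x0 => q (to_real x) y']
    = \int[P]_x (v x)%:E)%E.
  rewrite unlock; apply: (integral_eq_off_null_set mM M0) => x Mx.
  by rewrite vE.
have EXu : ('E_P[fun x : borel_on x0 => (to_real x * q (to_real x) y)%R]
    = \int[P]_x (to_real x * u x)%R%:E)%E.
  rewrite unlock; apply: (integral_eq_off_null_set mM M0) => x Mx.
  by rewrite uE.
have EXv : ('E_P[fun x : borel_on x0 => (to_real x * q (to_real x) y')%R]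
    = \int[P]_x (to_real x * v x)%R%:E)%E.
  rewrite unlock; apply: (integral_eq_off_null_set mM M0) => x Mx.
  by rewrite vE.
rewrite /bayes_mean /Rintegral -Eu -Ev -EXu -EXv => le.
(* The denominators are positive by [bayes_dom]. Finiteness has to be checked as well, since [fine]
   sends [+oo] to 0. *)
have fine_pos z : (0 < z)%E -> z \is a fin_num -> 0 < fine z :> R.
  by move=> z0 zf; rewrite -lte_fin fineK.
rewrite ler_pdivrMr; last first.
  by apply: fine_pos => //; rewrite Eu; exact: integrable_fin_num ui.
rewrite mulrAC ler_pdivlMr //.
by apply: fine_pos => //; rewrite Ev; exact: integrable_fin_num vi.
Qed.

(** * Necessity, by two-point distributions *)

(** [P] is the image of a fair coin. Every [f], measurable or not, agrees off the null set
    complementary to [[set a; b]] with a combination of two indicators. *)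
Lemma two_point_distribution d (T : measurableType d) (R : realType) (a b : T) :
  a != b -> measurable [set a] -> measurable [set b] ->
  exists P : probability T R, forall f : T -> R,
    Defs.integrable_ae P f /\ ('E_P[f] = (2^-1 * (f a + f b))%:E)%E.
Proof.
move=> ab ma mb; pose phi (c : bool) := if c then a else b.
have mphi : measurable_fun setT phi by [].
pose Phi : {mfun bool >-> T} :=
  HB.pack phi (isMeasurableFun.Build _ _ _ _ phi mphi).
pose P : probability T R := distribution (bernoulli_prob 2^-1) Phi.
have PE A : P A = (2^-1 * ((a \in A)%:R + (b \in A)%:R))%:E.
  rewrite /P /= /distribution /pushforward bernoulli_probE; last first.
    by apply/andP; split; lra.
  rewrite !diracE /= -!EFinM -EFinD; congr (_%:E).
  have -> : (true \in phi @^-1` A) = (a \in A).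
    by apply/idP/idP => /set_mem/mem_set.
  have -> : (false \in phi @^-1` A) = (b \in A).
    by apply/idP/idP => /set_mem/mem_set.
  by rewrite /unstable.onem; lra.
exists P => f.
have mab : measurable [set a; b] by exact: measurableU.
have N0 : P (~` [set a; b]) = 0%E.
  by rewrite PE !memNset ?addr0 ?mulr0 //; apply; (by left) || by right.
pose g t := f a * \1_[set a] t + f b * \1_[set b] t.
have gE t : ~ (~` [set a; b]) t -> g t = f t.
  move=> /contrapT[->|->]; rewrite /g !indicE.
    by rewrite mem_set // memNset ?mulr0 ?addr0 ?mulr1 //; exact/eqP.
  rewrite memNset; last exact/nesym/eqP.
  by rewrite mem_set // mulr0 add0r mulr1.
have indic_int (c : T) : measurable [set c] ->
    P.-integrable setT (EFin \o (\1_[set c] : T -> R)).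
  by move=> mc; exact: integrable_indic.
have Zint (r : R) (c : T) : measurable [set c] ->
    P.-integrable setT (EFin \o (fun t => r * \1_[set c] t)).
  move=> mc.
  by apply: eq_integrable (integrableZl measurableT r (indic_int c mc)).
have gi : P.-integrable setT (EFin \o g).
  have := integrableD measurableT (Zint (f a) a ma) (Zint (f b) b mb).
  by apply: eq_integrable.
have int_indicE c : measurable [set c] ->
    \int[P]_t \1_[set c] t = fine (P [set c]).
  by move=> mc; rewrite /Rintegral integral_indic // setIT.
split.
  exists g; split; first exact: gi.
  exists (~` [set a; b]); split; [exact: measurableC|exact: N0|].
  by move=> t /= gt Nt; apply: gt; apply: gE => /=.
rewrite (_ : 'E_P[f]%E = \int[P]_t (g t)%:E)%E; last first.
  rewrite unlock; apply: (integral_eq_off_null_set _ N0).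
    exact: measurableC.
  by move=> t Nt; rewrite gE.
rewrite -[LHS]fineK; last exact: integrable_fin_num gi.
congr (_%:E); rewrite -/(Rintegral P setT g).
rewrite RintegralD //; [|exact: Zint|exact: Zint].
rewrite !RintegralZl //; [|exact: indic_int|exact: indic_int].
have neq : a <> b by exact/eqP.
rewrite !int_indicE // !PE /= (@mem_set _ [set a] a) //.
rewrite (@mem_set _ [set b] b) // (@memNset _ [set b] a) //.
by rewrite (@memNset _ [set a] b) /=; [lra|exact: nesym].
Qed.

Lemma measurable_borel_on_set1 {R : realType} (X : set R) (x0 : X)
  (a : borel_on x0) : measurable [set a].
Proof.
exists [set to_real a]; first exact: measurable_set1.
by apply/seteqP; split=> [t [_ /= ta]|t ->]; [exact: val_inj|split].
Qed.

Lemma bayes_is_prox_monotone_likelihood_ratio {R : realType} (X Y : set R)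
    (q : R -> R -> R) :
  (forall x y, X x -> Y y -> 0 <= q x y) ->
  bayes_is_prox X Y q -> monotone_likelihood_ratio X Y q.
Proof.
move=> q0 isprox x x' y y' Xx Xx' Yy Yy' xx' yy'.
pose a : X := exist _ x (mem_set Xx); pose b : X := exist _ x' (mem_set Xx').
have ab : (a : borel_on a) != b.
  by apply/eqP => /(congr1 val) /= xeq; rewrite xeq ltxx in xx'.
have [P EP] := two_point_distribution R ab
  (measurable_borel_on_set1 (a : borel_on a))
  (measurable_borel_on_set1 (b : borel_on a)).
have adm : admissible Y q P by move=> z _; have [] := EP (fun t =>
  (1 + `|to_real t|) * q (to_real t) z).
have fmono := implements_prox_nondecreasing (isprox a P adm).
have Eq z : ('E_P[fun t : borel_on a => q (to_real t) z]
    = (2^-1 * (q x z + q x' z))%:E)%E.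
  by have [] := EP (fun t => q (to_real t) z).
have EXq z : ('E_P[fun t : borel_on a => (to_real t * q (to_real t) z)%R]
    = (2^-1 * (x * q x z + x' * q x' z))%:E)%E.
  by have [] := EP (fun t => to_real t * q (to_real t) z).
have dom z : Y z -> 0 < q x z + q x' z -> z \in bayes_dom Y q P.
  by move=> Yz qz; apply/mem_set; split=> //; rewrite Eq lte_fin mulr_gt0.
have meanE z : bayes_mean q P z =
    (x * q x z + x' * q x' z) / (q x z + q x' z).
  by rewrite /bayes_mean Eq EXq /= -mulf_div divff ?invr_eq0 ?pnatr_eq0 ?mul1r.
have [p0 p'0] : 0 <= q x y /\ 0 <= q x' y by split; exact: q0.
have [r0 r'0] : 0 <= q x y' /\ 0 <= q x' y' by split; exact: q0.
(* If the normalizer vanishes, [bayes_dom] excludes the point, but by nonnegativity both likelihoods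
   are zero and so is the required difference. *)
have [py|] := ltP 0 (q x y + q x' y); last first.
  move=> p_le0; have [-> ->] : q x y = 0 /\ q x' y = 0 by split; lra.
  by rewrite !mulr0 subrr.
have [py'|] := ltP 0 (q x y' + q x' y'); last first.
  move=> r_le0; have [-> ->] : q x y' = 0 /\ q x' y' = 0 by split; lra.
  by rewrite !mul0r subrr.
have := fmono y y' (dom _ Yy py) (dom _ Yy' py') (ltW yy').
rewrite !meanE ler_pdivrMr // mulrAC ler_pdivlMr // => le.
(* The right side of [le] minus its left side is [x' - x] times the required quantity. *)
rewrite -(pmulr_rge0 _ (_ : 0 < x' - x)) ?subr_gt0 //.
by lra.
Qed.

(** * Logarithmic forms of the likelihood ratio condition *)

(** The condition is symmetric in its two variables, so each criterion in [y] yields the matching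
    one in [x]. *)
Lemma monotone_likelihood_ratio_swap {R : realType} (X Y : set R)
    (q : R -> R -> R) :
  monotone_likelihood_ratio X Y q <->
  monotone_likelihood_ratio Y X (fun y x => q x y).
Proof.
by split=> mlr x x' y y' Xx Xx' Yy Yy' xx' yy';
  have := mlr y y' x x' Yy Yy' Xx Xx' yy' xx';
  rewrite [_ * q _ _ in X in _ - X]mulrC.
Qed.

Lemma monotone_likelihood_ratio_ln {R : realType} (X Y : set R)
    (q : R -> R -> R) :
  positive_on X Y q ->
  monotone_likelihood_ratio X Y q <->
  forall x x', X x -> X x' -> x < x' ->
    {in Y &, nondecreasing_fun (fun y => ln (q x' y) - ln (q x y))}.
Proof.
move=> q0.
have lnE x x' y y' :
    X x -> X x' -> Y y -> Y y' ->
    (ln (q x' y) - ln (q x y) <= ln (q x' y') - ln (q x y')) =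
    (0 <= q x' y' * q x y - q x y' * q x' y).
  move=> Xx Xx' Yy Yy'; rewrite subr_ge0 lerBlDr addrAC lerBrDr.
  rewrite -!lnM ?posrE; try exact: q0.
  rewrite ler_ln ?posrE; try by apply: mulr_gt0; exact: q0.
  by rewrite [q x' y * _]mulrC.
split=> [mlr x x' Xx Xx' xx' y y' /set_mem Yy /set_mem Yy'|mono].
  rewrite le_eqVlt => /predU1P[->//|yy'].
  by rewrite lnE //; exact: mlr.
move=> x x' y y' Xx Xx' Yy Yy' xx' yy'; rewrite -lnE //.
by apply: mono => //; [exact: mem_set|exact: mem_set|exact: ltW].
Qed.

(** * Derivatives within a set and their signs *)

Lemma within_dnbhs_proper {R : realType} (A : set R) (x : R) :
  limit_point A x -> ProperFilter (within A x^').
Proof.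
move=> Ax; split; last exact: within_filter.
by move=> /Ax[z [zx Az]]; apply.
Qed.

Lemma derivable_withinB {R : realType} (A : set R) (f g : R -> R) (x : R) :
  derivable_within A f x -> derivable_within A g x ->
  derivable_within A (f \- g) x /\
  derive_within A (f \- g) x = derive_within A f x - derive_within A g x.
Proof.
move=> [Ax cf] [_ cg]; have pF := within_dnbhs_proper Ax.
pose sf z := (z - x)^-1 * (f z - f x); pose sg z := (z - x)^-1 * (g z - g x).
have slopeB : (fun z => (z - x)^-1 * ((f \- g) z - (f \- g) x)) = sf - sg.
  by apply/funext => z /=; rewrite /sf /sg !fctE; ring.
split; first by split => //; rewrite slopeB; exact: is_cvgB.
by rewrite /derive_within slopeB; exact: limB.
Qed.

Lemma nondecreasing_derive_within_ge0 {R : realType} (A : set R) (f : R -> R)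
    (x : R) :
  A x -> {in A &, nondecreasing_fun f} -> derivable_within A f x ->
  0 <= derive_within A f x.
Proof.
move=> Ax fmono [lAx cf]; have pF := within_dnbhs_proper lAx.
apply: limr_ge => //; rewrite near_withinE; apply: nearW => z Az.
have [zx|xz] := leP z x.
  rewrite mulr_le0 ?invr_le0 ?subr_le0 //.
  by apply: fmono => //; exact: mem_set.
rewrite mulr_ge0 ?invr_ge0 ?subr_ge0 ?(ltW xz) //.
by apply: fmono; [exact: mem_set|exact: mem_set|exact: ltW].
Qed.

Lemma derivable_within_cvg {R : realType} (A : set R) (f : R -> R) (x : R) :
  derivable_within A f x -> f @ within A (nbhs x) --> f x.
Proof.
move=> [Ax cf]; have pF := within_dnbhs_proper Ax.
pose L := derive_within A f x.
have sL : (z - x)^-1 * (f z - f x) @[z --> within A x^'] --> L by [].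
(* Near [x] the slopes are within 1 of [L], hence bounded by [C], so [f z] differs from [f x] by at
   most [C * |x - z|]. *)
pose C := `|L| + 1; have C0 : 0 < C by rewrite ltr_wpDl.
apply/cvgrPdist_lt => e e0; rewrite near_withinE.
have /cvgrPdist_lt /(_ 1 ltr01) := sL.
rewrite near_withinE /dnbhs near_withinE => near1.
have near2 : \forall z \near x, `|x - z| < e / C.
  by apply: (@nbhsx_ballx R R x (e / C)); exact: divr_gt0.
near=> z => Az; have [->|zx] := eqVneq z x; first by rewrite subrr normr0.
have slope1 : `|L - (z - x)^-1 * (f z - f x)| < 1.
  by move: zx Az; near: z.
have zxe : `|x - z| < e / C by near: z.
have sC : `|(z - x)^-1 * (f z - f x)| <= C.
  have := ler_normB L (L - (z - x)^-1 * (f z - f x)).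
  by rewrite subKr => /le_trans; apply; rewrite lerD2l ltW.
have -> : f x - f z = ((z - x)^-1 * (f z - f x)) * (x - z).
  by field; rewrite subr_eq0.
rewrite normrM; apply: le_lt_trans (ler_wpM2r (normr_ge0 _) sC) _.
by rewrite mulrC -ltr_pdivlMr.
Unshelve. all: by end_near. Qed.

(** Points near [x] lie in [A] automatically, so the restriction to [A] disappears; the substitution
    [z = x + h] then gives the usual difference quotient. *)
Lemma derivable_within_interior {R : realType} (A : set R) (f : R -> R)
    (x : R) :
  nbhs x A -> derivable_within A f x -> is_derive x 1 f (derive_within A f x).
Proof.
move=> nA [Ax cf]; have pF := within_dnbhs_proper Ax.
set L := derive_within A f x.
have sL : (z - x)^-1 * (f z - f x) @[z --> within A x^'] --> L by [].
have dL : (h^-1 *: ((f \o shift x) (h *: (1 : R)) - f x)) @[h --> 0^'] --> L.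
  apply/cvgrPdist_lt => e e0.
  move/cvgrPdist_lt : sL => /(_ e e0).
  rewrite near_withinE /dnbhs !near_withinE => near1.
  have : \forall z \near x, z != x -> `|L - (z - x)^-1 * (f z - f x)| < e.
    near=> z => zx; have Az : A z by near: z.
    by move: zx Az; near: z.
  rewrite nbhs0P; apply: filterS => h hx h0 /=.
  have := hx; rewrite addrC -subr_eq0 addrK => /(_ h0).
  by rewrite /shift /= scaler1.
apply: DeriveDef; first by apply/cvg_ex; exists L.
exact: cvg_lim dL.
Unshelve. all: by end_near. Qed.

(** Since [A] is an interval, it contains all of [[a, b]]. The derivatives are ordinary ones inside,
    and at the endpoints continuity within [A] suffices for the mean value argument. *)
Lemma derive_within_ge0_nondecreasing {R : realType} (A : set R) (f : R -> R) :
  is_interval A -> (forall x, A x -> derivable_within A f x) ->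
  (forall x, A x -> 0 <= derive_within A f x) ->
  {in A &, nondecreasing_fun f}.
Proof.
move=> iA df f0 a b /set_mem Aa /set_mem Ab ab.
have abA z : z \in `[a, b] -> A z.
  by rewrite in_itv /= => zab; exact: iA Aa Ab _ zab.
have isd z : z \in `]a, b[ -> is_derive z 1 f (derive_within A f z).
  move=> zab; have Az : A z by apply: abA; exact: subset_itv_oo_cc zab.
  apply: derivable_within_interior (df _ Az).
  apply: filterS (near_in_itvoo zab) => t tab.
  by apply: abA; exact: subset_itv_oo_cc tab.
apply: (@ger0_derive1_le_cc R f a b); rewrite ?in_itv /= ?lexx ?ab //.
- by move=> z zab; have [] := isd z zab.
- move=> z zab; rewrite derive1E (@derive_val _ _ _ _ _ _ _ (isd z zab)).
  by apply/f0/abA; exact: subset_itv_oo_cc zab.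
- apply/subspace_continuousP => z zab.
  apply: cvg_trans (derivable_within_cvg (df _ (abA z zab))).
  apply: cvg_fmap2 => U; rewrite /within /=; apply: filterS => t UA tab.
  by apply: UA; exact: abA.
Qed.

(** For [x < x'] the function [ln (q x' t) - ln (q x t)] of [t] is nondecreasing exactly when its
    derivative, the difference of the two log-derivatives, is nonnegative. *)
Lemma monotone_likelihood_ratio_derive {R : realType} (X Y : set R)
    (q : R -> R -> R) :
  is_interval Y -> positive_on X Y q ->
  (forall x y, X x -> Y y -> derivable_within Y (fun t => ln (q x t)) y) ->
  monotone_likelihood_ratio X Y q <->
  forall y, Y y ->
    {in X &, nondecreasing_fun
      (fun x => derive_within Y (fun t => ln (q x t)) y)}.
Proof.
move=> iY q0 dq; rewrite monotone_likelihood_ratio_ln //.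
have dqB x x' y : X x -> X x' -> Y y ->
    derivable_within Y (fun t => ln (q x' t) - ln (q x t)) y /\
    derive_within Y (fun t => ln (q x' t) - ln (q x t)) y =
    derive_within Y (fun t => ln (q x' t)) y -
    derive_within Y (fun t => ln (q x t)) y.
  by move=> Xx Xx' Yy; exact: derivable_withinB (dq _ _ Xx' Yy) (dq _ _ Xx Yy).
split=> [mono y Yy x x' /set_mem Xx /set_mem Xx'|mono x x' Xx Xx' xx'].
  rewrite le_eqVlt => /predU1P[->//|xx'].
  have [dd dE] := dqB _ _ _ Xx Xx' Yy; rewrite -subr_ge0 -dE.
  by apply: nondecreasing_derive_within_ge0 => //; exact: mono.
apply: derive_within_ge0_nondecreasing => // y Yy;
  have [dd dE] := dqB _ _ _ Xx Xx' Yy; rewrite // dE subr_ge0.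
by apply: mono => //; [exact: mem_set|exact: mem_set|exact: ltW].
Qed.

(** * The equivalences assembled *)

Theorem lemma1 (R : realType) (X Y : set R) (q : R -> R -> R)
    (q_ge0 : forall x y, X x -> Y y -> 0 <= q x y) :
  [/\ bayes_is_prox X Y q <-> monotone_likelihood_ratio X Y q,

      positive_on X Y q ->
        (monotone_likelihood_ratio X Y q <->
          forall y y', Y y -> Y y' -> y < y' ->
            {in X &, nondecreasing_fun (fun x => ln (q x y') - ln (q x y))})
        /\
        (monotone_likelihood_ratio X Y q <->
          forall x x', X x -> X x' -> x < x' ->
            {in Y &, nondecreasing_fun (fun y => ln (q x' y) - ln (q x y))}),

      is_interval Y -> positive_on X Y q ->
      (forall x y, X x -> Y y -> derivable_within Y (fun t => ln (q x t)) y) ->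
        (monotone_likelihood_ratio X Y q <->
          forall y, Y y ->
            {in X &, nondecreasing_fun
              (fun x => derive_within Y (fun t => ln (q x t)) y)})

    & is_interval X -> positive_on X Y q ->
      (forall x y, X x -> Y y -> derivable_within X (fun s => ln (q s y)) x) ->
        (monotone_likelihood_ratio X Y q <->
          forall x, X x ->
            {in Y &, nondecreasing_fun
              (fun y => derive_within X (fun s => ln (q s y)) x)})].
Proof.
have q_swap : positive_on X Y q -> positive_on Y X (fun y x => q x y).
  by move=> q0 y x Yy Xx; exact: q0.
split.
- split; first exact: bayes_is_prox_monotone_likelihood_ratio.
  exact: monotone_likelihood_ratio_is_prox.
- move=> q0; split; last exact: monotone_likelihood_ratio_ln.
  (* Monotonicity in [x] is the criterion for monotonicity in [y] with the two variables
     exchanged. *)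
  rewrite monotone_likelihood_ratio_swap.
  exact/monotone_likelihood_ratio_ln/q_swap.
- exact: monotone_likelihood_ratio_derive.
- move=> iX q0 dq; rewrite monotone_likelihood_ratio_swap.
  apply: monotone_likelihood_ratio_derive => //; first exact: q_swap.
  by move=> y x Yy Xx; exact: dq.
Qed.
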